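(* The set of all exo-stratified formulae of the enriched syntax, regarded as a set of strings over the alphabet $\{[,\ ],\ \to,\ \forall,\ \doteq,\ \in,\ v,\ \circledast,\ \star,\ \bot\}$, is a context-free language.
   Context: A language (set of finite strings over a finite alphabet) is context-free if it is the set of all terminal strings generated from the start symbol of some context-free grammar (finite sets of nonterminals and production rules, each rule replacing a single nonterminal by a finite string of terminals and nonterminals). Enriched syntax of set theory: the alphabet consists of the symbols $[$, $]$, $\to$, $\forall$, $\doteq$ (equality symbol), $\in$, $v$, $\circledast$, $\star$, $\bot$. The variables are the strings $v_n^m := v\circledast^n\star^m$ for $n,m\in\mathbb{N}$ ($v$ followed by $n$ copies of $\circledast$ and then $m$ copies of $\star$). The atomic formulae are $\bot$ and the strings $\alpha\doteq\beta$ and $\alpha\in\beta$ for variables $\alpha,\beta$. Every atomic formula is a formula, and if $\varphi,\psi$ are formulae and $\alpha$ is a variable then $[\varphi\to\psi]$ and $[\forall\alpha]\varphi$ are formulae. A formula $\varphi$ in the enriched syntax is exo-stratified if: (1) whenever $v_{n_1}^{m_1}\doteq v_{n_2}^{m_2}$ appears as a subformula of $\varphi$, $m_1=m_2$; and (2) whenever $v_{n_1}^{m_1}\in v_{n_2}^{m_2}$ appears as a subformula of $\varphi$, $m_1=m_2-1$. (No restriction is imposed on $n_1,n_2$, nor on the variables occurring in quantifier prefixes $[\forall\alpha]$ other than through the atomic subformulae.) *)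

(* Defs.v *)
From HB Require Import structures.
From Stdlib Require Import Relation_Operators.
From mathcomp Require Import all_boot.

Set Implicit Arguments.
Unset Strict Implicit.
Unset Printing Implicit Defensive.

Definition language (T : finType) := seq T -> Prop.

Record cfg (T : finType) := Cfg {
  nonterminal : finType;
  start : nonterminal;
  rules : seq (nonterminal * seq (nonterminal + T))
}.

Inductive cfg_step (T : finType) (G : cfg T) :
    seq (nonterminal G + T) -> seq (nonterminal G + T) -> Prop :=
  CfgStep (A : nonterminal G) (r u w : seq (nonterminal G + T)) :
    (A, r) \in rules G -> cfg_step (u ++ inl A :: w) (u ++ r ++ w).

Definition cfg_derives (T : finType) (G : cfg T) :=
  clos_refl_trans (seq (nonterminal G + T)) (@cfg_step T G).

Definition cfg_language (T : finType) (G : cfg T) : language T :=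
  fun w => cfg_derives [:: inl (start G)] (map inr w).

Definition context_free (T : finType) (L : language T) : Prop :=
  exists G : cfg T, forall w : seq T, L w <-> cfg_language G w.

Inductive symbol : Type :=
  | LBracket | RBracket | Arrow | Forall | EqSym | InSym
  | Vee (* the letter v *) | Circledast | Star | Bot.

Definition symbols : seq symbol :=
  [:: LBracket; RBracket; Arrow; Forall; EqSym; InSym;
      Vee; Circledast; Star; Bot].

Definition symbol_code (s : symbol) : 'I_10 :=
  inord (match s with
    | LBracket => 0 | RBracket => 1 | Arrow => 2 | Forall => 3 | EqSym => 4
    | InSym => 5 | Vee => 6 | Circledast => 7 | Star => 8 | Bot => 9
  end).

Definition symbol_decode (i : 'I_10) : symbol := nth Bot symbols i.

Lemma symbol_codeK : cancel symbol_code symbol_decode.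
Proof. by case; rewrite /symbol_decode /symbol_code inordK. Qed.

HB.instance Definition _ := Finite.copy symbol (can_type symbol_codeK).

(* [var n m] is the variable with subscript [n] and superscript [m]. *)
Definition var (n m : nat) : seq symbol :=
  Vee :: nseq n Circledast ++ nseq m Star.

Definition variable (a : seq symbol) : Prop := exists n m, a = var n m.

Definition eq_str (a b : seq symbol) : seq symbol := a ++ EqSym :: b.
Definition in_str (a b : seq symbol) : seq symbol := a ++ InSym :: b.
Definition imp_str (p q : seq symbol) : seq symbol :=
  LBracket :: p ++ Arrow :: q ++ [:: RBracket].
Definition all_str (a p : seq symbol) : seq symbol :=
  [:: LBracket, Forall & a ++ RBracket :: p].

Inductive atomic_formula : seq symbol -> Prop :=
  | AtomBot : atomic_formula [:: Bot]
  | AtomEq a b : variable a -> variable b -> atomic_formula (eq_str a b)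
  | AtomIn a b : variable a -> variable b -> atomic_formula (in_str a b).

Inductive formula : seq symbol -> Prop :=
  | FormulaAtom p : atomic_formula p -> formula p
  | FormulaImp p q : formula p -> formula q -> formula (imp_str p q)
  | FormulaAll a p : variable a -> formula p -> formula (all_str a p).

(* [subformula s p]: [s] is a subformula of [p] in the syntactic sense.  This
   is not the same as being a formula and a contiguous substring: for instance
   [in_str (var 0 0) (var 0 0)] is a substring, but not a subformula, of
   [in_str (var 0 0) (var 0 1)]. *)
Inductive subformula : seq symbol -> seq symbol -> Prop :=
  | SubRefl p : formula p -> subformula p p
  | SubImpL s p q :
      formula p -> formula q -> subformula s p -> subformula s (imp_str p q)
  | SubImpR s p q :
      formula p -> formula q -> subformula s q -> subformula s (imp_str p q)
  | SubAll s a p :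
      variable a -> formula p -> subformula s p -> subformula s (all_str a p).

(* The condition m1 = m2 - 1 on membership is written without natural-number
   subtraction, whose truncation would wrongly allow m1 = m2 = 0. *)
Definition exo_stratified (p : seq symbol) : Prop :=
  [/\ formula p,
      forall n1 m1 n2 m2,
        subformula (eq_str (var n1 m1) (var n2 m2)) p -> m1 = m2
    & forall n1 m1 n2 m2,
        subformula (in_str (var n1 m1) (var n2 m2)) p -> m1 + 1 = m2].

(* Main.v *)
(** The equality sign of an atomic formula sits between the two blocks of stars
    that have to be matched, and only circles separate it from the second block.
    So a nonterminal generating the words [*^m = v o^n *^m] can grow its two
    blocks of stars from the inside out, and similarly for membership.  That the
    restriction on atomic subformulae can be imposed where the atoms are
    generated is unique readability. *)

From HB Require Import structures.
From Stdlib Require Import Relation_Operators.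
Require Import Defs.
From mathcomp Require Import all_boot.

Set Implicit Arguments.
Unset Strict Implicit.
Unset Printing Implicit Defensive.

(** * Derivations and languages of a context-free grammar *)

Section Grammars.

Variables (T : finType) (G : cfg T).
Implicit Types (A : nonterminal G) (f g r : seq (nonterminal G + T)).
Implicit Types (w : seq T).

Lemma cfg_derives_context f g u v :
  cfg_derives f g -> cfg_derives (u ++ f ++ v) (u ++ g ++ v).
Proof.
elim=> {f g} [_ _ [A r u' v' Ar]|f|f g h _ IHf _ IHg].
- apply: rt_step; rewrite -!catA !cat_cons [u ++ _]catA [u ++ u' ++ _]catA.
  exact: CfgStep.
- exact: rt_refl.
- exact: rt_trans IHf IHg.
Qed.

Definition yields f w : Prop := cfg_derives f (map inr w).

Lemma yields_nil : yields [::] [::].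
Proof. exact: rt_refl. Qed.

Lemma yields_terminal a f w : yields f w -> yields (inr a :: f) (a :: w).
Proof. by move=> /(@cfg_derives_context _ _ [:: inr a] [::]); rewrite !cats0. Qed.

Lemma yields_cat f g u w : yields f u -> yields g w -> yields (f ++ g) (u ++ w).
Proof.
move=> fu gw; rewrite /yields map_cat.
apply: (rt_trans _ _ _ (map inr u ++ g)).
  exact: (@cfg_derives_context _ _ [::] g fu).
by have := @cfg_derives_context _ _ (map inr u) [::] gw; rewrite !cats0.
Qed.

Lemma yields_nonterminal A f u w :
  yields [:: inl A] u -> yields f w -> yields (inl A :: f) (u ++ w).
Proof. exact: (@yields_cat [:: inl A]). Qed.

Lemma yields_rule A r w :
  (A, r) \in rules G -> yields r w -> yields [:: inl A] w.
Proof.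
move=> Ar; apply: rt_trans; apply: rt_step.
by have := @CfgStep _ G A r [::] [::] Ar; rewrite /= cats0.
Qed.

(** The monoid morphism from sentential forms to languages under concatenation that extends [I],
    each terminal standing for its one-letter language. *)
Fixpoint form_language (I : nonterminal G -> language T) f : language T :=
  match f with
  | [::] => fun w => w = [::]
  | inl A :: f' => fun w =>
      exists u v, [/\ w = u ++ v, I A u & form_language I f' v]
  | inr a :: f' => fun w => exists2 v, w = a :: v & form_language I f' v
  end.

Lemma form_language_cat I f g w :
  form_language I (f ++ g) w <->
  exists u v, [/\ w = u ++ v, form_language I f u & form_language I g v].
Proof.
elim: f w => [|[A|a] f IHf] w /=; split.
- by exists [::], w.
- by case=> _ [v [-> ->]].
- case=> u [_ [-> Au /IHf[v [v' [-> fv gv']]]]].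
  by exists (u ++ v), v'; split; rewrite ?catA //; exists u, v.
- case=> _ [v' [-> [u [v [-> Au fv]] gv']]].
  by exists u, (v ++ v'); rewrite catA; split=> //; apply/IHf; exists v, v'.
- case=> _ -> /IHf[u [v [-> fu gv]]].
  by exists (a :: u), v; split=> //; exists u.
- case=> _ [v [-> [u -> fu] gv]].
  by exists (u ++ v) => //; apply/IHf; exists u, v.
Qed.

(** The generated languages are the least solution of the inclusions that the rules express, so any
    assignment closed under the rules bounds them from above. *)
Lemma cfg_language_sound (I : nonterminal G -> language T) :
  (forall A r w, (A, r) \in rules G -> form_language I r w -> I A w) ->
  forall w, cfg_language G w -> I (start G) w.
Proof.
move=> closedI w.
(* Along a derivation the language of the sentential form can only shrink, since the language of [r]
   lies inside [I A] for each rule. *)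
have step f g : cfg_derives f g ->
    forall w', form_language I g w' -> form_language I f w'.
  elim=> {f g} [_ _ [A r u v Ar] w'|//|f g h _ IHf _ IHg w' /IHg/IHf //].
  case/form_language_cat=> u' [_ [-> uu' /form_language_cat[r' [v' [-> rr' vv']]]]].
  apply/form_language_cat; exists u', (r' ++ v'); split=> //=.
  by exists r', v'; split=> //; apply: closedI Ar rr'.
have self w' : form_language I (map inr w') w'.
  by elim: w' => //= a w' IHw; exists w'.
by case/step/(_ w (self w)) => u [_ [-> Iu ->]]; rewrite cats0.
Qed.

End Grammars.

(** * Unique readability *)

(** Both leading runs of [s] are maximal, so the string determines their length. *)
Lemma nseq_cat_inj (T : Type) (s : T) m n x y :
  ohead x <> Some s -> ohead y <> Some s ->
  nseq m s ++ x = nseq n s ++ y -> m = n /\ x = y.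
Proof.
move=> xs ys; elim: m n => [|m IHm] [|n] //=.
- by move=> xE; rewrite xE in xs.
- by move=> yE; rewrite -yE in ys.
- by case=> /IHm[-> ->].
Qed.

(* What may follow a variable without being absorbed by it. *)
Definition ends_var (x : seq symbol) : bool :=
  if x is (Circledast | Star) :: _ then false else true.

Lemma var_cat_inj n m n' m' x x' :
  var n m ++ x = var n' m' ++ x' -> ends_var x -> ends_var x' ->
  [/\ n = n', m = m' & x = x'].
Proof.
rewrite /var /= -!catA => -[+ xe x'e].
(* The run of circles is maximal even when no star follows it, because [ends_var] excludes circles
   as well as stars. *)
have headC k y : ends_var y -> ohead (nseq k Star ++ y) <> Some Circledast.
  by case: k y => [|k] [|[]].
have headS y : ends_var y -> ohead y <> Some Star by case: y => [|[]].
case/(nseq_cat_inj (headC _ _ xe) (headC _ _ x'e))=> ->.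
by case/(nseq_cat_inj (headS _ xe) (headS _ x'e))=> -> ->.
Qed.

Lemma variable_cat_inj a b x y :
  a ++ x = b ++ y -> variable a -> variable b -> ends_var x -> ends_var y ->
  a = b /\ x = y.
Proof.
move=> + [n [m aE]] [n' [m' bE]] xe ye; rewrite {}aE {}bE.
by move=> /var_cat_inj[] // -> -> ->.
Qed.

Lemma formula_head p : formula p ->
  [\/ ohead p = Some Bot, ohead p = Some Vee | ohead p = Some LBracket].
Proof.
case=> [{}p ap|*|*]; [|by constructor 3..].
by case: ap => [|_ b [n [m ->]] _|_ b [n [m ->]] _];
  [constructor 1|constructor 2..].
Qed.

(** This separates implications from quantifications: both open with a bracket, but only in the
    latter is the next letter [Forall]. *)
Lemma formula_not_Forall p x y : formula p -> p ++ x <> Forall :: y.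
Proof. by move=> /formula_head; case: p => [[]|c p [] [->]]. Qed.

(** Isolated from [formula_cat_inj] because, read symmetrically, it settles every case with an atom
    on either side. *)
Lemma atomic_cat_inj p q x y : atomic_formula p ->
  p ++ x = q ++ y -> formula q -> ends_var x -> ends_var y -> p = q /\ x = y.
Proof.
move=> ap + fq xe ye; case: fq => [{}q aq|q1 q2 _ _|a q1 _ _]; last 2 first.
- by case: ap => // a b [n [m ->]].
- by case: ap => // a' b [n [m ->]].
case: ap => [|a b va vb|a b va vb]; case: aq => [|a' b' va' vb'|a' b' va' vb'].
all: rewrite /eq_str /in_str -?catA //=.
- by case.
- by case: va' => n [m ->].
- by case: va' => n [m ->].
- by case: va => n [m ->].
- by move=> /variable_cat_inj[] // -> [] /variable_cat_inj[] // -> ->.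
- by move=> /variable_cat_inj[].
- by case: va => n [m ->].
- by move=> /variable_cat_inj[].
- by move=> /variable_cat_inj[] // -> [] /variable_cat_inj[] // -> ->.
Qed.

(** Formulae do not form a prefix code, as stars or circles appended to an atom's last variable may
    give another atom; [ends_var] rules this out. The induction preserves it: what follows a
    component starts with [Arrow] or [RBracket], or is the original remainder. *)
Lemma formula_cat_inj p q x y : formula p ->
  p ++ x = q ++ y -> formula q -> ends_var x -> ends_var y -> p = q /\ x = y.
Proof.
move=> fp; elim: fp q x y => [{}p ap|p1 p2 fp1 IH1 fp2 IH2|a p1 va fp1 IH] q x y.
- exact: atomic_cat_inj.
- move=> + fq xe ye; case: fq => [{}q aq|q1 q2 fq1 fq2|b q1 vb fq1].
  + move=> /esym/(atomic_cat_inj aq)[] //.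
    exact: FormulaImp.
  + rewrite /imp_str /= -!catA /= -!catA => -[].
    by move=> /IH1[] // -> [] /IH2[] // -> [->].
  + rewrite /imp_str /all_str /= -!catA => -[].
    by move/(formula_not_Forall fp1).
- move=> + fq xe ye; case: fq => [{}q aq|q1 q2 fq1 fq2|b q1 vb fq1].
  + move=> /esym/(atomic_cat_inj aq)[] //.
    exact: FormulaAll.
  + rewrite /imp_str /all_str /= -!catA => -[] /esym.
    by move/(formula_not_Forall fq1).
  + rewrite /all_str /= -!catA => -[].
    by move=> /variable_cat_inj[] // -> [] /IH[] // -> ->.
Qed.

Lemma imp_str_inj p q p' q' :
  imp_str p q = imp_str p' q' ->
  formula p -> formula q -> formula p' -> formula q' -> p = p' /\ q = q'.
Proof.
move=> [+ fp fq fp' fq'] => /(formula_cat_inj fp)[] // -> [].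
by move=> /(formula_cat_inj fq)[].
Qed.

Lemma all_str_inj a p b q :
  all_str a p = all_str b q -> variable a -> variable b -> a = b /\ p = q.
Proof. by move=> [+ va vb] => /variable_cat_inj[] // -> []. Qed.

Lemma imp_str_neq_all p q a r : formula p -> imp_str p q <> all_str a r.
Proof. by move=> fp [] /(formula_not_Forall fp). Qed.

Lemma atomic_neq_imp s p q : atomic_formula s -> s <> imp_str p q.
Proof. by case=> // a b [n [m ->]]. Qed.

Lemma atomic_neq_all s a p : atomic_formula s -> s <> all_str a p.
Proof. by case=> // b c [n [m ->]]. Qed.

(** * Atomic subformulae and exo-stratification *)

Lemma subformula_atomic s p : atomic_formula p -> subformula s p -> s = p.
Proof.
move=> ap sp; case: sp ap => // [||] {s p}.
- by move=> s p q _ _ _ /atomic_neq_imp /(_ erefl).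
- by move=> s p q _ _ _ /atomic_neq_imp /(_ erefl).
- by move=> s a p _ _ _ /atomic_neq_all /(_ erefl).
Qed.

(** Since [subformula] speaks of bare strings, inverting it requires that [imp_str p q] be parsed in
    only one way. Atomicity of [s] discards the reflexive case. *)
Lemma subformula_imp s p q : formula p -> formula q -> atomic_formula s ->
  subformula s (imp_str p q) -> subformula s p \/ subformula s q.
Proof.
move=> fp fq as_ sub; move: {-2}(imp_str p q) sub (erefl (imp_str p q)) as_ => r.
case=> {s r}.
- by move=> r _ <- /atomic_neq_imp /(_ erefl).
- by move=> s p' q' fp' fq' sp' /imp_str_inj[] // -> _; left.
- by move=> s p' q' fp' fq' sq' /imp_str_inj[] // _ ->; right.
- by move=> s a r _ _ _ /(imp_str_neq_all fp).
Qed.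

Lemma subformula_all s a p : variable a -> atomic_formula s ->
  subformula s (all_str a p) -> subformula s p.
Proof.
move=> va as_ sub; move: {-2}(all_str a p) sub (erefl (all_str a p)) as_ => r.
case=> {s r}.
- by move=> r _ <- /atomic_neq_all /(_ erefl).
- by move=> s p' q' fp' _ _ /esym/(imp_str_neq_all fp').
- by move=> s p' q' fp' _ _ /esym/(imp_str_neq_all fp').
- by move=> s b r vb _ sr /all_str_inj[] // _ ->.
Qed.

(** Exo-stratification imposed where atoms are formed, without mention of subformulae; the
    constructors match the five rules for [Formulae] in the grammar. *)
Inductive stratified : seq symbol -> Prop :=
  | StratBot : stratified [:: Bot]
  | StratEq n1 n2 m : stratified (eq_str (var n1 m) (var n2 m))
  | StratIn n1 n2 m : stratified (in_str (var n1 m) (var n2 m.+1))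
  | StratImp p q : stratified p -> stratified q -> stratified (imp_str p q)
  | StratAll n m p : stratified p -> stratified (all_str (var n m) p).

Lemma variable_var n m : variable (var n m).
Proof. by exists n, m. Qed.
#[local] Hint Resolve variable_var : core.

Lemma stratified_formula p : stratified p -> formula p.
Proof.
elim=> *; by [exact: FormulaImp | exact: FormulaAll |
  apply: FormulaAtom; do [exact: AtomBot | exact: AtomEq | exact: AtomIn]].
Qed.

Lemma eq_str_var_inj n1 m1 n2 m2 n1' m1' n2' m2' :
  eq_str (var n1 m1) (var n2 m2) = eq_str (var n1' m1') (var n2' m2') ->
  m1 = m1' /\ m2 = m2'.
Proof.
move=> /var_cat_inj[] // _ -> [] eq2.
(* The second variable ends the string, hence the empty remainders. *)
by case: (@var_cat_inj n2 m2 n2' m2' [::] [::]); rewrite // !cats0 /var eq2.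
Qed.

Lemma in_str_var_inj n1 m1 n2 m2 n1' m1' n2' m2' :
  in_str (var n1 m1) (var n2 m2) = in_str (var n1' m1') (var n2' m2') ->
  m1 = m1' /\ m2 = m2'.
Proof.
move=> /var_cat_inj[] // _ -> [] eq2.
by case: (@var_cat_inj n2 m2 n2' m2' [::] [::]); rewrite // !cats0 /var eq2.
Qed.

Lemma eq_str_neq_in_str a b c d :
  variable a -> variable c -> eq_str a b <> in_str c d.
Proof. by move=> va vc /variable_cat_inj[]. Qed.

(** Inversion traces an atomic subformula down to the atom that introduced it, and the superscripts
    can be read off that string. *)
Lemma stratified_exo p : stratified p -> exo_stratified p.
Proof.
move=> sp; split; first exact: stratified_formula.
- move=> n1 m1 n2 m2.
  have atE: atomic_formula (eq_str (var n1 m1) (var n2 m2)) by exact: AtomEq.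
  elim: sp => [||| p' q' sp IHp sq IHq|n m p' _ IHp].
  + by move/(subformula_atomic AtomBot).
  + move=> k1 k2 k /subformula_atomic-/(_ (AtomEq _ _)) sE.
    by case: (eq_str_var_inj (sE _ _)) => // -> ->.
  + move=> k1 k2 k /subformula_atomic-/(_ (AtomIn _ _)) sE.
    by case: (eq_str_neq_in_str _ _ (sE _ _)).
  + by case/subformula_imp=> //; apply: stratified_formula.
  + by move/subformula_all=> sub; apply/IHp/sub.
- move=> n1 m1 n2 m2.
  have atE: atomic_formula (in_str (var n1 m1) (var n2 m2)) by exact: AtomIn.
  elim: sp => [||| p' q' sp IHp sq IHq|n m p' _ IHp].
  + by move/(subformula_atomic AtomBot).
  + move=> k1 k2 k /subformula_atomic-/(_ (AtomEq _ _)) sE.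
    by case: (eq_str_neq_in_str _ _ (esym (sE _ _))).
  + move=> k1 k2 k /subformula_atomic-/(_ (AtomIn _ _)) sE.
    by case: (in_str_var_inj (sE _ _)) => // -> ->; rewrite addn1.
  + by case/subformula_imp=> //; apply: stratified_formula.
  + by move/subformula_all=> sub; apply/IHp/sub.
Qed.

(** From left to right, an atom is its own subformula, so the conditions apply to it directly; for
    compound formulae they are inherited by the components. *)
Lemma exo_stratifiedE p : exo_stratified p <-> stratified p.
Proof.
split=> [[fp]|]; last exact: stratified_exo.
elim: fp => {p} [_ []|p q fp IHp fq IHq|_ p [n [m ->]] fp IHp].
- by move=> *; exact: StratBot.
- move=> _ _ [n1 [m1 ->]] [n2 [m2 ->]] eqs _.
  rewrite (eqs n1 m1 n2 m2); first exact: StratEq.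
  by apply: SubRefl; apply: FormulaAtom; exact: AtomEq.
- move=> _ _ [n1 [m1 ->]] [n2 [m2 ->]] _ ins.
  rewrite -(ins n1 m1 n2 m2); first by rewrite addn1; exact: StratIn.
  by apply: SubRefl; apply: FormulaAtom; exact: AtomIn.
- move=> eqs ins; apply: StratImp.
    apply: IHp => n1 m1 n2 m2 s; first exact/(eqs n1 _ n2)/SubImpL.
    exact/(ins n1 _ n2)/SubImpL.
  apply: IHq => n1 m1 n2 m2 s; first exact/(eqs n1 _ n2)/SubImpR.
  exact/(ins n1 _ n2)/SubImpR.
- move=> eqs ins; apply: StratAll.
  apply: IHp => n1 m1 n2 m2 s; first exact/(eqs n1 _ n2)/SubAll.
  exact/(ins n1 _ n2)/SubAll.
Qed.

(** * The grammar *)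

Inductive category : Type :=
  | Formulae | Circles | Stars | EqTails | InTails.

Definition category_code (c : category) : 'I_5 :=
  inord (match c with
    | Formulae => 0 | Circles => 1 | Stars => 2 | EqTails => 3 | InTails => 4
  end).

Definition category_decode (i : 'I_5) : category :=
  nth Formulae [:: Formulae; Circles; Stars; EqTails; InTails] i.

Lemma category_codeK : cancel category_code category_decode.
Proof. by case; rewrite /category_decode /category_code inordK. Qed.

HB.instance Definition _ := Finite.copy category (can_type category_codeK).

(** A tail begins with the stars of the first variable, whose [Vee] and circles come from the rule
    for [Formulae]. The extra [Star] in the base rule for [InTails] is the offset of one between
    superscripts. A quantified variable is unconstrained, so its stars come from the independent
    [Stars]. *)
Definition stratified_cfg : cfg symbol := {|
  nonterminal := category;
  start := Formulae;
  rules := [::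
    (Formulae, [:: inr Bot]);
    (Formulae, [:: inr Vee; inl Circles; inl EqTails]);
    (Formulae, [:: inr Vee; inl Circles; inl InTails]);
    (Formulae, [:: inr LBracket; inl Formulae; inr Arrow; inl Formulae;
                   inr RBracket]);
    (Formulae, [:: inr LBracket; inr Forall; inr Vee; inl Circles; inl Stars;
                   inr RBracket; inl Formulae]);
    (Circles, [::]);
    (Circles, [:: inr Circledast; inl Circles]);
    (Stars, [::]);
    (Stars, [:: inr Star; inl Stars]);
    (EqTails, [:: inr EqSym; inr Vee; inl Circles]);
    (EqTails, [:: inr Star; inl EqTails; inr Star]);
    (InTails, [:: inr InSym; inr Vee; inl Circles; inr Star]);
    (InTails, [:: inr Star; inl InTails; inr Star])]
|}.

(** The assignment to which [cfg_language_sound] is applied. *)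
Definition category_language (c : category) (w : seq symbol) : Prop :=
  match c with
  | Formulae => stratified w
  | Circles => exists n, w = nseq n Circledast
  | Stars => exists n, w = nseq n Star
  | EqTails => exists n m, w = nseq m Star ++ EqSym :: var n m
  | InTails => exists n m, w = nseq m Star ++ InSym :: var n m.+1
  end.

(** The recursive tail rules add a star at the right end, whereas [nseq] grows on the left. *)
Lemma nseq_rcons (T : Type) n (a : T) : nseq n a ++ [:: a] = a :: nseq n a.
Proof. by elim: n => //= n ->. Qed.

Lemma category_language_closed A r w :
  (A, r) \in rules stratified_cfg ->
  form_language (G := stratified_cfg) category_language r w ->
  category_language A w.
Proof.
(* One case for each rule, in the order of the list. *)
rewrite !inE; do !case/orP; move=> /eqP[-> ->] /=.
- by case=> _ -> ->; exact: StratBot.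
- case=> _ -> [_ [_ [-> [n1 ->] [_ [_ [-> [n2 [m ->]] ->]]]]]].
  rewrite cats0.
  by have := StratEq n1 n2 m; rewrite /eq_str {1}/var /= -catA.
- case=> _ -> [_ [_ [-> [n1 ->] [_ [_ [-> [n2 [m ->]] ->]]]]]].
  rewrite cats0.
  by have := StratIn n1 n2 m; rewrite /in_str {1}/var /= -catA.
- case=> _ -> [p [_ [-> sp [_ -> [q [_ [-> sq [_ -> ->]]]]]]]].
  exact: StratImp.
- case=> _ -> [_ -> [_ -> [_ [_ [-> [n ->] [_ [v [-> [m ->] wE]]]]]]]].
  case: wE => {v} _ -> [p [_ [-> sp ->]]]; rewrite cats0.
  by have := StratAll n m sp; rewrite /all_str /var /= -catA.
- by move=> ->; exists 0.
- by case=> _ -> [_ [_ [-> [n ->] ->]]]; exists n.+1; rewrite cats0.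
- by move=> ->; exists 0.
- by case=> _ -> [_ [_ [-> [n ->] ->]]]; exists n.+1; rewrite cats0.
- case=> _ -> [_ -> [_ [_ [-> [n ->] ->]]]].
  by exists n, 0.
- case=> _ -> [_ [_ [-> [n [m ->]] [_ -> ->]]]].
  by exists n, m.+1; rewrite /var /= -catA /= -catA nseq_rcons.
- case=> _ -> [_ -> [_ [_ [-> [n ->] [_ -> ->]]]]].
  by exists n, 0.
- case=> _ -> [_ [_ [-> [n [m ->]] [_ -> ->]]]].
  by exists n, m.+1; rewrite /var /= -!catA /= -catA /= nseq_rcons.
Qed.

(** * Derivations of all stratified formulae *)

Notation cat_yields c := (@yields _ stratified_cfg [:: inl (c : category)]).

(* Rules are numbered from 0. *)
Ltac by_rule i :=
  apply: (@yields_rule _ stratified_cfg _ _ _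
    (@mem_nth _ (Formulae, [::]) (rules stratified_cfg) i isT)).

Lemma yields_circles n : cat_yields Circles (nseq n Circledast).
Proof.
elim: n => [|n IHn]; first by by_rule 5; exact: yields_nil.
by by_rule 6; exact: yields_terminal.
Qed.

Lemma yields_stars n : cat_yields Stars (nseq n Star).
Proof.
elim: n => [|n IHn]; first by by_rule 7; exact: yields_nil.
by by_rule 8; exact: yields_terminal.
Qed.

Lemma yields_eq_tails n m :
  cat_yields EqTails (nseq m Star ++ EqSym :: var n m).
Proof.
elim: m => [|m IHm].
  by_rule 9; do 2!apply: yields_terminal; rewrite cats0.
  exact: yields_circles.
(* The outermost pair of stars is exposed, as the recursive rule produces it first. *)
have -> : nseq m.+1 Star ++ EqSym :: var n m.+1 =
    Star :: (nseq m Star ++ EqSym :: var n m) ++ [:: Star].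
  by rewrite /var /= -catA /= -catA nseq_rcons.
by_rule 10; apply: yields_terminal; apply: yields_nonterminal => //.
exact/yields_terminal/yields_nil.
Qed.

Lemma yields_in_tails n m :
  cat_yields InTails (nseq m Star ++ InSym :: var n m.+1).
Proof.
elim: m => [|m IHm].
  by_rule 11; do 2!apply: yields_terminal.
  apply: yields_nonterminal; first exact: yields_circles.
  exact/yields_terminal/yields_nil.
have -> : nseq m.+1 Star ++ InSym :: var n m.+2 =
    Star :: (nseq m Star ++ InSym :: var n m.+1) ++ [:: Star].
  by rewrite /var /= -!catA /= -catA /= nseq_rcons.
by_rule 12; apply: yields_terminal; apply: yields_nonterminal => //.
exact/yields_terminal/yields_nil.
Qed.

Lemma yields_stratified p : stratified p -> cat_yields Formulae p.
Proof.
elim=> {p} [|n1 n2 m|n1 n2 m|p q _ IHp _ IHq|n m p _ IHp].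
- by by_rule 0; exact/yields_terminal/yields_nil.
(* Only the first variable is opened: its stars go to the tail, which contains the second variable
   whole. *)
- by_rule 1; rewrite /eq_str {1}/var /= -catA; apply: yields_terminal.
  apply: yields_nonterminal; [exact: yields_circles|exact: yields_eq_tails].
- by_rule 2; rewrite /in_str {1}/var /= -catA; apply: yields_terminal.
  apply: yields_nonterminal; [exact: yields_circles|exact: yields_in_tails].
- by_rule 3; apply: yields_terminal; apply: yields_nonterminal => //.
  apply: yields_terminal; apply: yields_nonterminal => //.
  exact/yields_terminal/yields_nil.
- by_rule 4; rewrite /all_str /var /= -catA; do 3!apply: yields_terminal.
  apply: yields_nonterminal; first exact: yields_circles.
  apply: yields_nonterminal; first exact: yields_stars.
  exact: yields_terminal.
Qed.

Theorem theorem4p3 : @context_free symbol exo_stratified.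
Proof.
exists stratified_cfg => w; apply: (iff_trans (exo_stratifiedE w)); split.
  exact: yields_stratified.
(* At the start symbol [Formulae], [category_language] is [stratified] by computation. *)
exact: (cfg_language_sound category_language_closed).
Qed.
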